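(* Let $\mathcal{P}^i(x^i),\mathcal{P}^j(x^j)\subset\mathbb{R}^2$ be state-dependent polygons satisfying the standing assumptions listed in the context, and let $\hat h_a(x)=\hat h_a(x;b,\kappa)$, $\hat{\mathcal{S}}_a=\hat{\mathcal{S}}_a(b,\kappa)=\{x\in\mathbb{R}^{2n}:\hat h_a(x;b,\kappa)\ge0\}$ and $\mathcal{S}$ be as defined there. Let $b\ge\ln(r^i+r^j)$ and let $\kappa>0$ be sufficiently large that $\hat{\mathcal{S}}_a(b,\kappa)$ is nonempty, and suppose $\hat h_a$ is a continuously differentiable barrier function candidate on $\hat{\mathcal{S}}_a$. If $$\nabla\hat h_a(x)\ne0\quad\text{for all }x\text{ satisfying }\hat h_a(x)=0,$$ then there exists an open neighborhood $\hat{\mathcal{D}}_a$ of $\hat{\mathcal{S}}_a$ such that: i) $\hat h_a$ is a control barrier function on $\hat{\mathcal{D}}_a$ for the system $\dot x=u$, $x,u\in\mathbb{R}^{2n}$. ii) Let $u_0=[(u_0^i)^\top,(u_0^j)^\top]^\top:\mathbb{R}^{2n}\to\mathbb{R}^{2n}$ be any locally Lipschitz continuous nominal controller, let $\alpha$ be any extended class-$\mathcal{K}$ function, and let $u_*(x)$ be the solution of the quadratic program $$u_*(x)=\operatorname*{argmin}_{u=[(u^i)^\top,(u^j)^\top]^\top\in\mathbb{R}^{2n}}\|u-u_0(x)\|^2\quad\text{s.t.}\quad(\nabla_{x^{\mathfrak i}}\hat h_a(x))^\top u^{\mathfrak i}\ge-\tfrac12\alpha(\hat h_a(x)),\ \ \forall\,\mathfrak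 i\in\{i,j\}.$$ Then the closed set $\hat{\mathcal{S}}_a$ is forward invariant for the resulting closed-loop system $\Sigma:\dot x=u_*(x)$, i.e. $x(0)\in\hat{\mathcal{S}}_a$ implies $x(t)\in\hat{\mathcal{S}}_a$ for all $t\ge0$ for every solution. As a result, $\Sigma$ is also safe with respect to $\mathcal{S}$: for $x(0)\in\hat{\mathcal{S}}_a$, $x(t)\in\mathcal{S}$ for all $t\ge0$.
   Context: Notation: $[r]=\{1,\dots,r\}$; $\|\cdot\|$ is the Euclidean norm. Polygons. Let $n\ge 2$. For $\mathfrak{i}\in\{i,j\}$ and $x^{\mathfrak i}\in\mathbb{R}^n$, let $\mathcal{P}^{\mathfrak i}(x^{\mathfrak i})\subset\mathbb{R}^2$ be a polygon with $r^{\mathfrak i}$ edges and $r^{\mathfrak i}$ vertices, given both as $\mathcal{P}^{\mathfrak i}(x^{\mathfrak i})=\bigcap_{k\in[r^{\mathfrak i}]}\{z\in\mathbb{R}^2:(A^{\mathfrak i}_k(x^{\mathfrak i}))^\top z\le b^{\mathfrak i}_k(x^{\mathfrak i})\}$ and as $\mathcal{P}^{\mathfrak i}(x^{\mathfrak i})=\operatorname{co}\{v^{\mathfrak i}_k(x^{\mathfrak i}):k\in[r^{\mathfrak i}]\}$ (convex hull), the $v^{\mathfrak i}_k(x^{\mathfrak i})\in\mathbb{R}^2$ being its vertices. Standing assumptions, for $\mathfrak{i}\in\{i,j\}$ and all $x^{\mathfrak i}\in\mathbb{R}^n$: $\mathcal{P}^{\mathfrak i}(x^{\mathfrak i})$ is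 convex, bounded, with non-empty interior; the maps $A^{\mathfrak i}_k:\mathbb{R}^n\to\mathbb{R}^2$ and $b^{\mathfrak i}_k:\mathbb{R}^n\to\mathbb{R}$ are continuously differentiable, and none of the $r^{\mathfrak i}$ inequalities is redundant; $\|A^{\mathfrak i}_k(x^{\mathfrak i})\|=1$ for every $k$; the maps $v^{\mathfrak i}_k:\mathbb{R}^n\to\mathbb{R}^2$ are continuously differentiable with Jacobian $\partial v^{\mathfrak i}_k/\partial x^{\mathfrak i}$ (a $2\times n$ matrix) always of full row rank. State: $x=[(x^i)^\top,(x^j)^\top]^\top\in\mathbb{R}^{2n}$, input $u=[(u^i)^\top,(u^j)^\top]^\top\in\mathbb{R}^{2n}$, dynamics $\dot x=u$ (i.e. $\dot x^{\mathfrak i}=u^{\mathfrak i}$). It is a standing assumption that for any initial condition the closed-loop system $\Sigma$ has a unique solution $x(t)$ existing for all $t\ge0$ (in particular the quadratic program has a solution along it). Safe set. For convex sets $\mathcal{A},\mathcal{B}\subset\mathbb{R}^2$ the signed distance is $\operatorname{sd}(\mathcal{A},\mathcal{B})=\inf_t\{\|t\|:(\mathcal{A}+t)\cap\mathcal{B}\ne\emptyset\}-\inf_t\{\|t\|:(\mathcal{A}+t)\cap\mathcal{B}=\emptyset\}$. Set $h_s(x)=\operatorname{sd}(\mathcal{P}^i(x^i),\mathcal{P}^j(x^j))$ and $\mathcal{S}=\{x\in\mathbb{R}^{2n}:h_s(x)\ge0\}$. Smooth function. With $\phi^{k^i}_{l^j}(x)=(A^i_{k^i}(x^i))^\top v^j_{l^j}(x^j)-b^i_{k^i}(x^i)$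 and $\psi^{k^j}_{l^i}(x)=(A^j_{k^j}(x^j))^\top v^i_{l^i}(x^i)-b^j_{k^j}(x^j)$ for $k^i,l^i\in[r^i]$, $k^j,l^j\in[r^j]$, and parameters $\kappa>0$, $b\in\mathbb{R}$, define $$\hat h_a(x;b,\kappa)=\frac1\kappa\ln\Big(\sum_{k^i\in[r^i]}\frac{1}{\sum_{l^j\in[r^j]}e^{-\kappa\phi^{k^i}_{l^j}(x)}}+\sum_{k^j\in[r^j]}\frac{1}{\sum_{l^i\in[r^i]}e^{-\kappa\psi^{k^j}_{l^i}(x)}}\Big)-\frac b\kappa .$$ Definitions. An extended class-$\mathcal{K}$ function is a continuous strictly increasing $\alpha:\mathbb{R}\to\mathbb{R}$ with $\alpha(0)=0$. Given a nonempty closed set $\mathcal{C}\subset\mathbb{R}^{m}$ with no isolated point, a barrier function (BF) candidate on $\mathcal{C}$ is a locally Lipschitz $h:\mathbb{R}^m\to\mathbb{R}$ with $h=0$ on $\partial\mathcal{C}$, $h>0$ on $\operatorname{Int}(\mathcal{C})$, $h<0$ on $\mathbb{R}^m\setminus\mathcal{C}$. A continuously differentiable BF candidate $h$ on $\mathcal{C}$ is a control barrier function (CBF) on an open set $\mathcal{D}\supset\mathcal{C}$ for the system $\dot x=u$ if there is an extended class-$\mathcal{K}$ function $\alpha$ such that for all $x\in\mathcal{D}$ the set $\{u:\nabla h(x)^\top u\ge-\alpha(h(x))\}$ is non-empty. *)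

(* Defs.v *)
(* Vectors are row vectors: a point of R^m is an element of 'rV[R]_m, and the
   stacked state [x^i; x^j] is an element of 'rV[R]_(n + n) whose two blocks
   are lsubmx x and rsubmx x.  The norm `|_| carried by 'rV[R]_m is the maximum
   norm; since it induces the usual topology and is equivalent to the Euclidean
   norm, it only serves topological notions (limits, differentiability, local
   Lipschitz continuity, boundedness).  Metric quantities use enorm. *)
From mathcomp Require Import all_boot all_order all_algebra.
From mathcomp Require Import all_classical all_reals all_analysis.

Set Implicit Arguments.
Unset Strict Implicit.
Unset Printing Implicit Defensive.

Import Order.TTheory GRing.Theory Num.Theory.
Import numFieldNormedType.Exports.

Local Open Scope classical_set_scope.
Local Open Scope ring_scope.

Definition dot (R : realType) (m : nat) (u v : 'rV[R]_m) : R :=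
  \sum_(i < m) u 0 i * v 0 i.

Definition enorm (R : realType) (m : nat) (u : 'rV[R]_m) : R :=
  Num.sqrt (dot u u).

(* The domain will always be finite dimensional, where continuity of
   x |-> 'd f x v for every v is continuity of the Jacobian matrix. *)
Definition cont_differentiable (R : realType) (V W : normedModType R)
    (f : V -> W) : Prop :=
  (forall x, differentiable f x) /\
  (forall v, continuous (fun x => 'd f x v)).

Definition grad (R : realType) (m : nat) (h : 'rV[R]_m -> R)
    (x : 'rV[R]_m) : 'rV[R]_m :=
  \row_(i < m) 'D_(delta_mx 0 i) h x.

(* The neighbourhoods are those of all pairs (x, y) in V * V; away from the
   diagonal the condition only says that f is locally bounded. *)
Definition locally_lipschitz (R : realType) (V W : normedModType R)
    (f : V -> W) : Prop :=
  [locally [lipschitz f x | x in [set: V]]].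

(* Both sets of norms are nonempty when A and B are nonempty and bounded, the
   only case in which sd is used; on an empty set, inf is the junk value 0. *)
Definition sd (R : realType) (m : nat) (A B : set 'rV[R]_m) : R :=
  let translate t := [set z + t | z in A] in
  inf [set enorm t | t in [set t | translate t `&` B !=set0]] -
  inf [set enorm t | t in [set t | translate t `&` B = set0]].

Definition conv_hull (R : realType) (m : nat) (A : set 'rV[R]_m) :
    set 'rV[R]_m :=
  smallest (fun C : set 'rV[R]_m => convex_set C) A.

Definition extreme_point (R : realType) (m : nat) (A : set 'rV[R]_m) :
    set 'rV[R]_m :=
  [set z | A z /\ forall (y w : 'rV[R]_m) (t : R), A y -> A w ->
    0 < t < 1 -> z = t *: y + (1 - t) *: w -> y = z /\ w = z].

(* A polygon depending on a state in R^n: its number r of edges (and of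
   vertices), and the maps A_k, b_k, v_k of its two descriptions. *)
Record polygon_family (R : realType) (n : nat) := PolygonFamily {
  nedges : nat;
  normal : 'I_nedges -> 'rV[R]_n -> 'rV[R]_2;
  offset : 'I_nedges -> 'rV[R]_n -> R;
  vertex : 'I_nedges -> 'rV[R]_n -> 'rV[R]_2
}.

Arguments normal {R n} p k x.
Arguments offset {R n} p k x.
Arguments vertex {R n} p k x.

Definition polygon (R : realType) (n : nat) (P : polygon_family R n)
    (x : 'rV[R]_n) : set 'rV[R]_2 :=
  [set z | forall k, dot (normal P k x) z <= offset P k x].

(* 'J f x acts on row vectors from the right, so it is the transpose of the
   usual 2 x n Jacobian matrix. *)
Record standing_assumptions (R : realType) (n : nat)
    (P : polygon_family R n) : Prop := StandingAssumptions {
  polygon_hull : forall x,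
    polygon P x = conv_hull [set vertex P k x | k in [set: 'I_(nedges P)]];
  polygon_vertices : forall x,
    [set vertex P k x | k in [set: 'I_(nedges P)]] =
    extreme_point (polygon P x);
  vertices_distinct : forall x, injective (fun k => vertex P k x);
  polygon_convex : forall x, convex_set (polygon P x);
  polygon_bounded : forall x, bounded_set (polygon P x);
  polygon_interior : forall x, (polygon P x)° !=set0;
  normal_C1 : forall k, cont_differentiable (normal P k);
  offset_C1 : forall k, cont_differentiable (offset P k);
  irredundant : forall x k,
    [set z | forall l, l != k -> dot (normal P l x) z <= offset P l x] <>
    polygon P x;
  normal_unit : forall x k, enorm (normal P k x) = 1;
  vertex_C1 : forall k, cont_differentiable (vertex P k);
  vertex_rank : forall k x, row_free ('J (vertex P k) x)^T
}.

Definition safe_fun (R : realType) (n : nat) (Pi Pj : polygon_family R n)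
    (x : 'rV[R]_(n + n)) : R :=
  sd (polygon Pi (lsubmx x)) (polygon Pj (rsubmx x)).

Definition safe_set (R : realType) (n : nat) (Pi Pj : polygon_family R n) :
    set 'rV[R]_(n + n) :=
  [set x | 0 <= safe_fun Pi Pj x].

(* phi^k_l is edge_gap Pi Pj k l x^i x^j and psi^k_l is
   edge_gap Pj Pi k l x^j x^i. *)
Definition edge_gap (R : realType) (n : nat) (P Q : polygon_family R n)
    (k : 'I_(nedges P)) (l : 'I_(nedges Q)) (x y : 'rV[R]_n) : R :=
  dot (normal P k x) (vertex Q l y) - offset P k x.

Definition h_hat (R : realType) (n : nat) (Pi Pj : polygon_family R n)
    (b kappa : R) (x : 'rV[R]_(n + n)) : R :=
  let xi := lsubmx x in
  let xj := rsubmx x in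
  kappa^-1 *
  ln (\sum_(k < nedges Pi)
        (\sum_(l < nedges Pj) expR (- (kappa * edge_gap k l xi xj)))^-1 +
      \sum_(k < nedges Pj)
        (\sum_(l < nedges Pi) expR (- (kappa * edge_gap k l xj xi)))^-1) -
  b / kappa.

Definition S_hat (R : realType) (n : nat) (Pi Pj : polygon_family R n)
    (b kappa : R) : set 'rV[R]_(n + n) :=
  [set x | 0 <= h_hat Pi Pj b kappa x].

Definition extended_class_K (R : realType) (alpha : R -> R) : Prop :=
  [/\ continuous alpha, {homo alpha : s t / s < t} & alpha 0 = 0].

Record bf_candidate (R : realType) (m : nat) (h : 'rV[R]_m -> R)
    (C : set 'rV[R]_m) : Prop := BFCandidate {
  bf_nonempty : C !=set0;
  bf_closed : closed C;
  bf_no_isolated : isolated C = set0;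
  bf_lipschitz : locally_lipschitz h;
  bf_boundary : forall x, (closure C `\` C°) x -> h x = 0;
  bf_interior : forall x, C° x -> 0 < h x;
  bf_exterior : forall x, ~ C x -> h x < 0
}.

(* h is a control barrier function on D for the single integrator x' = u. *)
Record control_barrier_function (R : realType) (m : nat) (h : 'rV[R]_m -> R)
    (C D : set 'rV[R]_m) : Prop := ControlBarrierFunction {
  cbf_candidate : bf_candidate h C;
  cbf_C1 : cont_differentiable h;
  cbf_open : open D;
  cbf_subset : C `<=` D;
  cbf_control : exists2 alpha : R -> R, extended_class_K alpha &
    forall x, D x ->
      [set u | - alpha (h x) <= dot (grad h x) u] !=set0
}.

Definition qp_feasible (R : realType) (n : nat) (h : 'rV[R]_(n + n) -> R)
    (alpha : R -> R) (x : 'rV[R]_(n + n)) : set 'rV[R]_(n + n) :=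
  [set u |
    - (2^-1 * alpha (h x)) <= dot (lsubmx (grad h x)) (lsubmx u) /\
    - (2^-1 * alpha (h x)) <= dot (rsubmx (grad h x)) (rsubmx u)].

(* Kept as a set: it has at most one element (the objective is strictly convex
   and the constraints are affine), and is empty where the program is
   infeasible. *)
Definition qp_argmin (R : realType) (n : nat) (h : 'rV[R]_(n + n) -> R)
    (u0 : 'rV[R]_(n + n) -> 'rV[R]_(n + n)) (alpha : R -> R)
    (x : 'rV[R]_(n + n)) : set 'rV[R]_(n + n) :=
  [set u | qp_feasible h alpha x u /\
    forall v, qp_feasible h alpha x v ->
      enorm (u - u0 x) ^+ 2 <= enorm (v - u0 x) ^+ 2].

(* x' = F(x) on [0, +oo[, where F x is the (at most one-element) set of values
   of the feedback at x.  The derivative at 0 is one-sided; the values of the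
   curve at negative times are irrelevant. *)
Definition solution (R : realType) (m : nat) (F : 'rV[R]_m -> set 'rV[R]_m)
    (x : R -> 'rV[R]_m) : Prop :=
  forall t : R, 0 <= t -> exists2 u, F (x t) u &
    (s - t)^-1 *: (x s - x t) @[s --> within [set s | 0 <= s] t^'] --> u.

Definition well_posed_on (R : realType) (m : nat)
    (F : 'rV[R]_m -> set 'rV[R]_m) (C : set 'rV[R]_m) : Prop :=
  forall x0, C x0 ->
    (exists2 x, solution F x & x 0 = x0) /\
    (forall x y, solution F x -> solution F y -> x 0 = x0 -> y 0 = x0 ->
      forall t, 0 <= t -> x t = y t).

Definition forward_invariant (R : realType) (m : nat)
    (F : 'rV[R]_m -> set 'rV[R]_m) (C : set 'rV[R]_m) : Prop :=
  forall x, solution F x -> C (x 0) -> forall t, 0 <= t -> C (x t).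

(* Main.v *)
(* If h_hat(x) >= 0, the r^i + r^j reciprocals under the logarithm add up to at
   least r^i + r^j, so one of them is >= 1; then every exponential in it is
   <= 1, i.e. all vertices of one polygon lie beyond an edge of the other, and
   that edge separates the two polygons.  For invariance, the constraints give
   h_hat a positive derivative along a solution wherever h_hat < 0; at a
   negative minimum on [0, t] it would then be smaller just before. *)
Require Import Defs.
From mathcomp Require Import all_boot all_order all_algebra.
From mathcomp Require Import all_classical all_reals all_analysis.
From mathcomp Require Import lra.

Set Implicit Arguments.
Unset Strict Implicit.
Unset Printing Implicit Defensive.

Import Order.TTheory GRing.Theory Num.Theory.
Import numFieldNormedType.Exports.

Local Open Scope classical_set_scope.
Local Open Scope ring_scope.

(** * Inner product, half-spaces and signed distance *)

Section Dot.
Variables (R : realType) (m : nat).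
Implicit Types (u v w : 'rV[R]_m) (c : R).

Lemma dotDr u v w : dot u (v + w) = dot u v + dot u w.
Proof.
by rewrite /dot -big_split; apply: eq_bigr => i _; rewrite mxE mulrDr.
Qed.

Lemma dotZr u c v : dot u (c *: v) = c * dot u v.
Proof.
by rewrite /dot mulr_sumr; apply: eq_bigr => i _; rewrite mxE mulrCA.
Qed.

Lemma dot_ge0 u : 0 <= dot u u.
Proof. by apply: sumr_ge0 => i _; rewrite -expr2 sqr_ge0. Qed.

Lemma dot_eq0 u : (dot u u == 0) = (u == 0).
Proof.
apply/eqP/eqP => [u0|->]; last by rewrite /dot big1// => i _; rewrite mxE mul0r.
apply/rowP => i; apply/eqP; rewrite mxE -sqrf_eq0 expr2.
move/psumr_eq0P: u0 => -> // j _; rewrite -expr2; exact: sqr_ge0.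
Qed.

Lemma enormZ c u : enorm (c *: u) = `|c| * enorm u.
Proof.
rewrite /enorm -sqrtr_sqr -sqrtrM ?sqr_ge0//; congr Num.sqrt.
by rewrite /dot mulr_sumr; apply: eq_bigr => i _; rewrite !mxE; lra.
Qed.

Lemma dot_enorm1 u : enorm u = 1 -> dot u u = 1.
Proof.
by move=> u1; rewrite -(sqr_sqrtr (dot_ge0 u)) [Num.sqrt _]u1 expr1n.
Qed.

Lemma dot_block (p : nat) (u v : 'rV[R]_(m + p)) :
  dot u v = dot (lsubmx u) (lsubmx v) + dot (rsubmx u) (rsubmx v).
Proof.
rewrite /dot big_split_ord; congr (_ + _);
by apply: eq_bigr => i _; rewrite !mxE.
Qed.

Lemma convex_halfspace_ge u c : convex_set [set z | c <= dot u z].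
Proof.
move=> /= y w l; rewrite !inE /= => cy cw.
rewrite [conv _ _ _](_ : _ =
  l%:num *: (y : 'rV[R]_m) + (1 - l%:num) *: (w : 'rV[R]_m))//.
have l0 : 0 <= l%:num by [].
have l1 : l%:num <= 1 by [].
by rewrite dotDr !dotZr; nra.
Qed.

(** The half-space is one of the convex sets that [smallest] intersects. *)
Lemma conv_hull_halfspace_ge u c (A : set 'rV[R]_m) :
  (forall z, A z -> c <= dot u z) ->
  forall z, conv_hull A z -> c <= dot u z.
Proof.
move=> Ac z; move/(_ [set z | c <= dot u z]); apply; split=> //.
exact: convex_halfspace_ge.
Qed.

Lemma diff_grad (h : 'rV[R]_m -> R) x u :
  differentiable h x -> 'd h x u = dot (grad h x) u.
Proof.
move=> dh; rewrite [in LHS](row_sum_delta u) linear_sum; apply: eq_bigr => i _.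
by rewrite linearZ /= mxE deriveE// mulrC.
Qed.

(* Arbitrarily small translations make A disjoint from B, so the second infimum
   in sd is 0. *)
Lemma sd_ge0 (A B : set 'rV[R]_m) u :
  (forall e, 0 < e -> [set z + e *: u | z in A] `&` B = set0) ->
  0 <= sd A B.
Proof.
move=> dis.
have enorm_lb (T : set 'rV[R]_m) : lbound [set enorm t | t in T] 0.
  by move=> _ [t _ <-]; exact: sqrtr_ge0.
rewrite /sd subr_ge0; apply: (@le_trans _ _ 0).
  apply/ler_addgt0Pr => e e0; rewrite add0r.
  (* The 1 keeps the denominator positive when [u] is zero; the scaled vector has norm at most
     [e]. *)
  have d0 : 0 < e / (enorm u + 1).
    by rewrite divr_gt0// ltr_wpDl// sqrtr_ge0.
  apply: (@le_trans _ _ (enorm ((e / (enorm u + 1)) *: u))).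
    apply: ge_inf; first by exists 0; exact: enorm_lb.
    by exists ((e / (enorm u + 1)) *: u) => //; exact: dis.
  rewrite enormZ gtr0_norm// mulrAC ler_pdivrMr ?ltr_wpDl ?sqrtr_ge0//.
  by rewrite ler_pM2l// lerDl.
set S := [set enorm _ | _ in _].
(* [S] belongs to the first infimum; if no translation makes the sets meet, [inf] takes its default
   value 0. *)
have [->|/set0P S0] := eqVneq S set0; first by rewrite inf0.
by apply: lb_le_inf => //; exact: enorm_lb.
Qed.

End Dot.

(** * Separation of the two polygons on [S_hat] *)

Section SmoothFunction.
Variables (R : realType) (n : nat).
Implicit Types P Q : polygon_family R n.

(** Without vertices the hull would lie in the convex set [set0], contradicting the non-empty
    interior. *)
Lemma nedges_gt0 P : standing_assumptions P -> (0 < nedges P)%N.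
Proof.
move=> hP; case: (posnP (nedges P)) => // P0.
have [z /interior_subset] := polygon_interior hP 0.
rewrite (polygon_hull hP) => /(_ set0) hull.
suff: (set0 : set 'rV[R]_2) z by [].
apply: hull; split; first by move=> y w l; rewrite inE.
by move=> y [[k kP]]; exfalso; rewrite P0 in kP.
Qed.

Lemma edge_gap_ge0 P Q k x y (kappa : R) : 0 < kappa ->
  1 <= (\sum_(l < nedges Q) expR (- (kappa * edge_gap (P:=P) k l x y)))^-1 ->
  forall l, 0 <= edge_gap (P:=P) (Q:=Q) k l x y.
Proof.
move=> kappa0; set s := \sum_(l < _) _ => s1 l.
have s0 : 0 < s by rewrite -invr_gt0 (lt_le_trans ltr01).
have : expR (- (kappa * edge_gap k l x y)) <= expR 0.
  rewrite expR0; apply: le_trans (_ : s <= 1); last first.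
    by move: s1; rewrite invf_pge ?posrE// invr1.
  rewrite /s (bigD1 l)//= lerDl sumr_ge0// => j _; exact: expR_ge0.
by rewrite ler_expR oppr_le0 pmulr_rge0.
Qed.

Lemma edge_gap_separates P Q k x y : standing_assumptions Q ->
  (forall l, 0 <= edge_gap (P:=P) (Q:=Q) k l x y) ->
  forall z, polygon Q y z -> offset P k x <= dot (normal P k x) z.
Proof.
move=> hQ gap z; rewrite (polygon_hull hQ); apply: conv_hull_halfspace_ge.
by move=> _ [l _ <-]; rewrite -subr_ge0; exact: gap.
Qed.

Lemma ltr_sum_ord (p : nat) (F G : 'I_p -> R) : (0 < p)%N ->
  (forall k, F k < G k) -> \sum_(k < p) F k < \sum_(k < p) G k.
Proof.
move=> p0 FG; apply: ltr_sum => //.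
by apply/hasP; exists (Ordinal p0); rewrite ?mem_index_enum.
Qed.

Lemma sum_ord_gt0 (p : nat) (F : 'I_p -> R) : (0 < p)%N ->
  (forall k, 0 < F k) -> 0 < \sum_(k < p) F k.
Proof. by move=> p0 /(ltr_sum_ord p0); rewrite big1. Qed.

(** If all terms were below 1, a nonempty sum of them would be strictly below [p]. *)
Lemma exists_ge1 (p : nat) (F : 'I_p -> R) : (0 < p)%N ->
  p%:R <= \sum_(k < p) F k -> exists k, 1 <= F k.
Proof.
move=> p0 sF; apply: contrapT => /forallNP F1.
have ltF k : F k < 1 by rewrite ltNge; apply/negP.
by have := ltr_sum_ord p0 ltF; rewrite sumr_const card_ord ltNge sF.
Qed.

Lemma S_hat_separated P Q (b kappa : R) (x : 'rV[R]_(n + n)) :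
  standing_assumptions P -> standing_assumptions Q ->
  ln (nedges P + nedges Q)%N%:R <= b -> 0 < kappa ->
  S_hat P Q b kappa x ->
  (exists k, forall l, 0 <= edge_gap (P:=P) (Q:=Q) k l (lsubmx x) (rsubmx x)) \/
  (exists k, forall l, 0 <= edge_gap (P:=Q) (Q:=P) k l (rsubmx x) (lsubmx x)).
Proof.
move=> hP hQ hb kappa0; rewrite /S_hat/= /h_hat [_^-1 * _]mulrC -mulrBl.
set s1 := \sum_(k < nedges P) _; set s2 := \sum_(k < nedges Q) _.
rewrite pmulr_lge0 ?invr_gt0// subr_ge0 => /(le_trans hb).
have NP0 : (0 < nedges P)%N by exact: nedges_gt0.
have NQ0 : (0 < nedges Q)%N by exact: nedges_gt0.
(* Comparing logarithms requires positive arguments, so one of the two sums must be strictly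
   positive. *)
have s10 : 0 < s1.
  apply: sum_ord_gt0 => // k; rewrite invr_gt0.
  by apply: sum_ord_gt0 => // l; exact: expR_gt0.
have s20 : 0 <= s2.
  apply: sumr_ge0 => k _; rewrite invr_ge0.
  by apply: sumr_ge0 => l _; exact: expR_ge0.
rewrite ler_ln ?posrE ?ltr0n ?addn_gt0 ?NP0 ?ltr_wpDr// natrD => sum_ge.
(* Either [s1] reaches its number of terms, or the deficit forces [s2] to reach its own. *)
have [s1P|s1P] := leP (nedges P)%:R s1.
  left; have [k Fk] := exists_ge1 NP0 s1P; exists k.
  exact: edge_gap_ge0 kappa0 Fk.
have s2Q : (nedges Q)%:R <= s2 by lra.
right; have [k Fk] := exists_ge1 NQ0 s2Q; exists k.
exact: edge_gap_ge0 kappa0 Fk.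
Qed.

Lemma S_hat_safe P Q (b kappa : R) :
  standing_assumptions P -> standing_assumptions Q ->
  ln (nedges P + nedges Q)%N%:R <= b -> 0 < kappa ->
  S_hat P Q b kappa `<=` safe_set P Q.
Proof.
move=> hP hQ hb kappa0 x /(S_hat_separated hP hQ hb kappa0)[[k gap]|[k gap]].
- have sep := edge_gap_separates hQ gap.
  (* The first polygon is the one translated. The edge is its own, so it retreats inward; as the
     normal has unit length, it ends a distance [e] inside that edge line. *)
  apply: (@sd_ge0 _ _ _ _ (- normal P k (lsubmx x))) => e e0.
  rewrite -subset0 => _ [[z Pz <-] /sep].
  rewrite dotDr dotZr -scaleN1r dotZr dot_enorm1; last exact: (normal_unit hP).
  by have := Pz k; lra.
- have sep := edge_gap_separates hP gap.
  (* Now the edge belongs to the other polygon, so the translated one moves outward along that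
     normal. *)
  apply: (@sd_ge0 _ _ _ _ (normal Q k (rsubmx x))) => e e0.
  rewrite -subset0 => _ [[z /sep Pz <-] /(_ k)].
  rewrite dotDr dotZr dot_enorm1; last exact: (normal_unit hQ).
  by lra.
Qed.

End SmoothFunction.

(** * Solutions and invariance under a barrier condition *)

Section Flow.
Variable R : realType.

(** Substituting s = h + t turns the quotient used in [solution] into the one defining the
    derivative. *)
Lemma is_derive_quotient (V : normedModType R) (f : R -> V) (t : R) (u : V) :
  (s - t)^-1 *: (f s - f t) @[s --> t^'] --> u -> is_derive t 1 f u.
Proof.
move=> ftu.
suff quot : h^-1 *: ((f \o shift t) (h *: 1) - f t) @[h --> 0^'] --> u.
  by apply: DeriveDef; [apply/cvg_ex; exists u|exact/cvg_lim].
have shift_t : h + t @[h --> (0 : R)^'] --> t^'.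
  move=> A; rewrite /dnbhs /within /= => tA.
  have : h + t @[h --> (0 : R)] --> 0 + t.
    by apply: cvgD; [exact: cvg_id|exact: cvg_cst].
  rewrite add0r => /(_ _ tA); apply: (@filterS _ (nbhs (0 : R))) => h Ah h0.
  by apply: Ah; rewrite -subr_eq0 addrK.
have := cvg_comp _ _ shift_t ftu.
apply: cvg_trans; apply: near_eq_cvg; near=> h.
by rewrite /= addrK [h *: 1]mulr1.
Unshelve. all: by end_near. Qed.

Section Solution.
Variables (m : nat) (F : 'rV[R]_m -> set 'rV[R]_m) (x : R -> 'rV[R]_m).
Hypothesis sol : solution F x.

(** Around a positive time the restriction to nonnegative times is vacuous, so the limit is
    two-sided. *)
Lemma solution_is_derive (t : R) : 0 < t ->
  exists2 u, F (x t) u & is_derive t 1 x u.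
Proof.
move=> t0; have [u Fu xu] := sol (ltW t0); exists u => //.
apply: is_derive_quotient; apply: cvg_trans xu; apply: cvg_app.
move=> A; rewrite /within /= => tA.
apply: (@filterS2 _ (nbhs t) _ _ _ _ _ tA (lt_nbhsr t0)) => s As s0 st.
exact: As st (ltW s0).
Qed.

(** At time 0 only a one-sided derivative exists; it still yields the continuity at the left
    endpoint needed for the extreme value theorem. *)
Lemma solution_right_continuous0 : x s @[s --> 0^'+] --> x 0.
Proof.
have [u _ xu] := sol (lexx 0).
have xu' : (s - 0)^-1 *: (x s - x 0) @[s --> 0^'+] --> u.
  apply: cvg_trans xu; apply: cvg_app => A; rewrite /at_right /dnbhs /within /=.
  apply: (@filterS _ (nbhs (0 : R))) => s As s0.
  by apply: As; [rewrite gt_eqF|exact: ltW].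
have : x 0 + s *: ((s - 0)^-1 *: (x s - x 0)) @[s --> 0^'+] --> x 0 + 0 *: u.
  apply: cvgD; first exact: cvg_cst.
  apply: cvgZ => //; apply: cvg_at_right_filter; exact: cvg_id.
rewrite scale0r addr0; apply: cvg_trans; apply: near_eq_cvg; near=> s.
have s0 : s != 0 by near: s; exact: nbhs_right_neq.
by rewrite [s - 0]subr0 (scalerKV s0) addrC subrK.
Unshelve. all: by end_near. Qed.

Lemma barrier_ge0 (h : 'rV[R]_m -> R) :
  (forall y, differentiable h y) ->
  (forall y u, F y u -> h y < 0 -> 0 < 'd h y u) ->
  0 <= h (x 0) -> forall t : R, 0 <= t -> 0 <= h (x t).
Proof.
move=> dh hF hx0 t; rewrite le0r => /predU1P[->//|t0].
rewrite leNgt; apply/negP => hxt.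
have dx (s : R) : 0 < s -> differentiable x s.
  move=> s0; have [u _ [xs _]] := solution_is_derive s0.
  exact/derivable1_diffP.
have cont : {within `[0, t], continuous (h \o x)}.
  apply/continuous_within_itvP => //; split.
  - move=> s /[!in_itv]/= /andP[s0 _].
    exact/differentiable_continuous/differentiable_comp/dh/dx.
  - apply: (cvg_comp _ _ solution_right_continuous0).
    exact: (differentiable_continuous (dh (x 0))).
  - apply: cvg_at_left_filter.
    exact/differentiable_continuous/differentiable_comp/dh/dx.
have [c /[!in_itv]/= /andP[c0 ct] minc] := EVT_min (ltW t0) cont.
have hxc : h (x c) < 0.
  by apply: le_lt_trans hxt; apply: minc; rewrite in_itv/= lexx ltW.
(* The minimum is negative while [h (x 0)] is not, so it is attained at a time where [x] is
   differentiable. *)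
have {}c0 : 0 < c.
  by move: c0; rewrite le0r => /predU1P[cE|//]; move: hxc; rewrite cE ltNge hx0.
have [u Fu [dxc xcu]] := solution_is_derive c0.
have dhx : differentiable (h \o x) c by exact/differentiable_comp/dh/dx.
have D0 : 0 < 'D_1 (h \o x) c.
  rewrite deriveE// diff_comp//=; last exact: dx.
  by rewrite -[X in 'd h _ X]deriveE ?xcu; [exact: hF|exact: dx].
(* The minimum may sit at the endpoint [t], so only quotients from the left stay inside the
   interval. *)
have : e^-1 *: ((h \o x \o shift c) (e *: 1) - (h \o x) c) @[e --> 0^'-]
    --> 'D_1 (h \o x) c.
  apply: cvg_dnbhs_at_left; have /derivable1_diffP/cvg_ex[l hl] := dhx.
  by rewrite /derive (cvg_lim _ hl).
move=> /cvgr_gt/(_ _ D0) quot_gt0.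
have [e [e0 ce]] : exists e, [/\ e < 0, - c < e &
    0 < e^-1 *: ((h \o x \o shift c) (e *: 1) - (h \o x) c)].
  apply: (@filter_ex _ (0^'-)); near=> e; split; near: e.
  - exact: nbhs_left_lt.
  - by apply: nbhs_left_gt; rewrite oppr_lt0.
  - exact: quot_gt0.
rewrite /= [e *: 1]mulr1 nmulr_rgt0 ?invr_lt0// subr_lt0 ltNge minc//.
by rewrite in_itv/=; apply/andP; split; lra.
Unshelve. all: by end_near. Qed.

End Solution.
End Flow.

Theorem theorem3 (R : realType) (n : nat) (hn : (2 <= n)%N)
    (Pi Pj : polygon_family R n)
    (hPi : standing_assumptions Pi) (hPj : standing_assumptions Pj)
    (b kappa : R)
    (hb : ln (nedges Pi + nedges Pj)%N%:R <= b)
    (hkappa : 0 < kappa)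
    (hS : S_hat Pi Pj b kappa !=set0)
    (hC1 : cont_differentiable (h_hat Pi Pj b kappa))
    (hBF : bf_candidate (h_hat Pi Pj b kappa) (S_hat Pi Pj b kappa))
    (hgrad : forall x, h_hat Pi Pj b kappa x = 0 ->
      grad (h_hat Pi Pj b kappa) x != 0) :
  exists D : set 'rV[R]_(n + n),
    [/\ open D, S_hat Pi Pj b kappa `<=` D,
      control_barrier_function (h_hat Pi Pj b kappa) (S_hat Pi Pj b kappa) D &
      forall (u0 : 'rV[R]_(n + n) -> 'rV[R]_(n + n)) (alpha : R -> R),
        locally_lipschitz u0 -> extended_class_K alpha ->
        let Sigma := qp_argmin (h_hat Pi Pj b kappa) u0 alpha in
        well_posed_on Sigma (S_hat Pi Pj b kappa) ->
        forward_invariant Sigma (S_hat Pi Pj b kappa) /\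
        (forall x : R -> 'rV[R]_(n + n), solution Sigma x ->
          S_hat Pi Pj b kappa (x 0) ->
          forall t, 0 <= t -> safe_set Pi Pj (x t))].
Proof.
set h := h_hat Pi Pj b kappa in hC1 hBF hgrad *.
have [dh ch] := hC1.
have cont_h : continuous h by move=> x; exact: differentiable_continuous.
(* The second set is where the differential is nonzero; written as a union over directions, it is
   open by continuity of each ['d h x v] in [x]. *)
pose D := h @^-1` [set y | 0 < y] `|`
  \bigcup_v (fun x => 'd h x v) @^-1` [set y | y != 0].
have oD : open D.
  apply: openU.
    by apply: open_comp => [x _|]; [exact: cont_h|exact: open_gt].
  apply: bigcup_open => v _; apply: open_comp => [x _|]; first exact: ch.
  exact: open_neq.
have SD : S_hat Pi Pj b kappa `<=` D.
  move=> x; rewrite /S_hat/= le0r -/h => /predU1P[hx0|]; last by left.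
  (* Along the gradient the differential is its squared norm. *)
  right; exists (grad h x) => //=; rewrite diff_grad//.
  by rewrite dot_eq0 hgrad.
exists D; split => //.
  (* With the identity as class-K function, the input 0 works where [h] is positive; elsewhere [v]
     is rescaled so that the derivative of [h] equals [- h x]. *)
  split => //; exists id.
    by split => // s; exact: cvg_id.
  move=> x [hx|[v _ /= dv]].
    by exists 0; rewrite /= -diff_grad// linear0 oppr_le0 ltW.
  exists (- h x / 'd h x v *: v).
  by rewrite /= -diff_grad// linearZ/= [_ *: _]mulfVK.
move=> u0 alpha _ [_ alpha_mono alpha0] Sigma _.
have inv : forward_invariant Sigma (S_hat Pi Pj b kappa).
  move=> x sol; apply: (barrier_ge0 sol dh) => y u [[ci cj] _] hy.
  (* The two constraints, half of the bound each, add up to a derivative of at least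
     [- alpha (h y)], which is positive here. *)
  have : alpha (h y) < 0 by rewrite -alpha0 alpha_mono.
  by rewrite diff_grad// dot_block; lra.
split => // x sol x0 t t0.
by apply: (S_hat_safe hPi hPj hb hkappa); exact: inv sol x0 t t0.
Qed.
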